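(* Let $G$ be a Garside group. Then the center $Z(G)$ of $G$ is cyclic if and only if any two Garside elements $\Delta_1,\Delta_2$ of $G$ (that is, for any two Garside structures $(G_1^+,\Delta_1)$ and $(G_2^+,\Delta_2)$ on $G$) are commensurable.
   Context: Garside groups. In a monoid $M$, an atom is an element $a\neq 1$ such that $a=bc$ implies $b=1$ or $c=1$; $\Vert a\Vert$ is the supremum of the lengths of expressions of $a$ as products of atoms. $M$ is atomic if it is generated by its atoms and $\Vert a\Vert<\infty$ for all $a\in M$. Put $a\le_L b$ if $ac=b$ for some $c\in M$, and $a\le_R b$ if $ca=b$ for some $c\in M$. A Garside monoid is an atomic, left and right cancellative monoid $M$ such that $(M,\le_L)$ and $(M,\le_R)$ are lattices and $M$ contains a Garside element $\Delta$, i.e. an element such that for each $a\in M$, $a\le_L\Delta$ iff $a\le_R\Delta$, and the set $[1,\Delta]=\{a\in M: 1\le_L a\le_L\Delta\}$ is finite and generates $M$. A Garside group $G$ is the group of fractions of a Garside monoid $M$; $M$ is identified with its image in $G$ and denoted $G^+$, and $(G^+,\Delta)$ is called a Garside structure on $G$. A group may have several Garside structures. A Garside element of $G$ is an element $\Delta$ occurring in some Garside structure $(G^+,\Delta)$ on $G$. Two elements $g,h$ of a group are commensurable if $g^k$ is conjugate to $h^\ell$ for some nonzero integers $k,\ell$. *)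

(* Defs.v *)
From mathcomp Require Import all_boot all_order all_algebra.
From mathcomp Require Import boolp classical_sets functions cardinality.
From Stdlib Require Relation_Definitions.
Set Implicit Arguments.
Unset Strict Implicit.
Unset Printing Implicit Defensive.

Local Open Scope classical_set_scope.
Local Open Scope group_scope.

Section Monoids.
Variable M : monoidType.
Implicit Types (a b c D : M) (s : seq M).

Definition left_cancellative : Prop := forall a b c, a * b = a * c -> b = c.
Definition right_cancellative : Prop := forall a b c, b * a = c * a -> b = c.

Definition atom : set M :=
  [set a | a <> 1 /\ forall b c, a = b * c -> b = 1 \/ c = 1].

Definition product_of (S : set M) (s : seq M) (a : M) : Prop :=
  (forall x, x \in s -> S x) /\ \prod_(x <- s) x = a.

Definition generates (S : set M) : Prop := forall a, exists s, product_of S s a.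

(* ||a|| < oo, where ||a|| is the supremum of the lengths of the expressions
   of a as a product of atoms. *)
Definition finite_norm (a : M) : Prop :=
  exists N : nat, forall s, product_of atom s a -> (size s <= N)%N.

Definition atomic : Prop := generates atom /\ forall a, finite_norm a.

Definition leL (a b : M) : Prop := exists c, a * c = b.
Definition leR (a b : M) : Prop := exists c, c * a = b.

Definition garside_interval (D : M) : set M := [set a | leL 1 a /\ leL a D].

Definition monoid_garside_element (D : M) : Prop :=
  [/\ forall a, leL a D <-> leR a D,
      finite_set (garside_interval D)
    & generates (garside_interval D)].

End Monoids.

Section Lattices.
Variables (T : Type) (le : T -> T -> Prop).

Definition is_join (x y z : T) : Prop :=
  [/\ le x z, le y z & forall w, le x w -> le y w -> le z w].

Definition is_meet (x y z : T) : Prop :=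
  [/\ le z x, le z y & forall w, le w x -> le w y -> le w z].

Definition is_lattice : Prop :=
  [/\ Relation_Definitions.order T le,
      forall x y, exists z, is_join x y z
    & forall x y, exists z, is_meet x y z].

End Lattices.

Definition garside_monoid (M : monoidType) : Prop :=
  [/\ atomic M,
      left_cancellative M /\ right_cancellative M,
      is_lattice (@leL M) /\ is_lattice (@leR M)
    & exists D : M, monoid_garside_element D].

(* [i] identifies the monoid [M] with its image in [G], and [G] is then the
   group of fractions of [M]. *)
Definition group_of_fractions (M : monoidType) (G : groupType) (i : M -> G) :
    Prop :=
  [/\ monoid_morphism i, injective i
    & forall g : G, exists a b : M, g = i a / i b].

(* [(G^+, i D)], where [G^+] is the image of [i], is a Garside structure
   on [G]. *)
Definition garside_structure (G : groupType) (M : monoidType) (i : M -> G)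
    (D : M) : Prop :=
  [/\ garside_monoid M, group_of_fractions i & monoid_garside_element D].

Definition garside_group (G : groupType) : Prop :=
  exists (M : monoidType) (i : M -> G),
    garside_monoid M /\ group_of_fractions i.

(* The monoid [M] is not fixed: it may be any Garside monoid with group of
   fractions [G]. *)
Definition garside_element (G : groupType) (g : G) : Prop :=
  exists (M : monoidType) (i : M -> G) (D : M),
    garside_structure i D /\ g = i D.

Section Groups.
Variable G : groupType.

Definition expgz (g : G) (k : int) : G :=
  match k with
  | Posz n => g ^+ n
  | Negz n => g ^- n.+1
  end.

Definition commensurable (g h : G) : Prop :=
  exists k l : int, [/\ k <> 0%R, l <> 0%R &
    exists x : G, expgz g k ^ x = expgz h l].

Definition group_center : set G := [set z | forall g : G, z * g = g * z].

Definition cyclic_subgroup (H : set G) : Prop :=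
  exists z : G, H = range (expgz z).

End Groups.

Arguments group_center G : clear implicits.

(* Main.v *)
Require Import Defs.
From mathcomp Require Import all_boot all_order all_algebra.
From mathcomp Require Import boolp classical_sets functions cardinality.
From mathcomp Require Import fingroup perm.

(* Conjugation by a Garside element permutes the finite set of its divisors,
   so some power of it is central; if the centre is cyclic, such powers of two
   Garside elements have a common power.
   Conversely, let d be a central power of D and z a central element. For N
   large z d^N is a Garside element, so commensurability makes a nonzero power
   of z equal to a power of d. Roots of central elements are monotone for
   divisibility, so z or z^-1 lies in the monoid. Hence divisibility is a total
   order on the centre, and its least positive element generates it. *)

Local Open Scope classical_set_scope.
Local Open Scope group_scope.

(** * Central powers of Garside elements *)

(** Conjugation by [x] restricts to an injective self-map of the finite set [A], hence a
    permutation; [m] is its order. *)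
Lemma conjg_expg_finite_order (G : groupType) (x : G) (A : set G) :
  finite_set A -> (forall a, A a -> A (a ^ x)) ->
  exists2 m, (0 < m)%N & forall a, A a -> commute (x ^+ m) a.
Proof.
move=> /finite_seqP[s ->] As.
pose f (a : seq_sub s) : seq_sub s := SeqSub (As (ssval a) (ssvalP a)).
have f_inj : injective f.
  by move=> a b [] /conjg_inj eq_ab; apply: val_inj.
exists #[perm f_inj]; first exact: order_gt0.
move=> a sa; set n := #[_].
have iterE k b : ssval (iter k f b) = ssval b ^ (x ^+ k).
  by elim: k => [|k IHk]; rewrite ?expg0 ?conjg1 // expgSr conjgM -IHk.
have : iter n f (SeqSub sa) = SeqSub sa.
  by rewrite -(eq_iter (permE f_inj)) -permX expg_order perm1.
move=> /(congr1 (@ssval _ _)); rewrite iterE /= => ax.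
by rewrite /commute [RHS]conjgC ax.
Qed.

Lemma group_centerV (G : groupType) (z : G) :
  group_center G z -> group_center G z^-1.
Proof. by move=> zC g; apply/commute_sym/commuteV/commute_sym/zC. Qed.

Lemma group_centerM (G : groupType) (y z : G) :
  group_center G y -> group_center G z -> group_center G (y * z).
Proof. by move=> yC zC g; apply/commute_sym/commuteM; apply/commute_sym. Qed.

Lemma group_centerX (G : groupType) (z : G) n :
  group_center G z -> group_center G (z ^+ n).
Proof. by move=> zC g; apply/commute_sym/commuteX/commute_sym/zC. Qed.

Lemma commute_group_of_fractions (M : monoidType) (G : groupType)
    (i : M -> G) (g : G) :
  group_of_fractions i -> (forall a, commute g (i a)) ->
  forall h, commute g h.
Proof.
move=> [_ _ frac] ga h; have [a [b ->]] := frac h.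
by apply: commuteM; [|apply: commuteV]; apply: ga.
Qed.

Lemma generates_ind (M : monoidType) (S : set M) (K : M -> Prop) :
  generates S -> K 1 -> (forall s a, S s -> K a -> K (s * a)) ->
  forall a, K a.
Proof.
move=> genS K1 KM a; have [s [sS <-]] := genS a.
elim: s sS => [|x s IHs] sS; first by rewrite big_nil.
rewrite big_cons; apply: KM; first by apply: sS; rewrite mem_head.
by apply: IHs => y ys; apply: sS; rewrite inE ys orbT.
Qed.

Lemma morphX (M N : monoidType) (i : M -> N) :
  monoid_morphism i -> forall n, {morph i : x / x ^+ n}.
Proof. by move=> [i1 iM]; elim=> [|n IHn] x; rewrite ?i1 // !expgS iM IHn. Qed.

(** Complementing twice realises conjugation by [D]: if [a * b = D] and [b * c = D], then
    [a * D = a * b * c = D * c]. *)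
Lemma leL_conj_garside (M : monoidType) (D a : M) :
  (forall b, leL b D <-> leR b D) -> leL a D ->
  exists2 b, leL b D & a * D = D * b.
Proof.
move=> bal [b abD]; have /bal[c bcD] : leR b D by exists a.
by exists c; [apply/bal; exists b | rewrite -{1}bcD mulgA abD].
Qed.

Lemma garside_power_central {M : monoidType} {G : groupType} {i : M -> G}
    {D : M} :
  group_of_fractions i -> monoid_garside_element D ->
  exists2 m, (0 < m)%N & forall g, commute (i D ^+ m) g.
Proof.
move=> fracG [bal finD genD]; have [[i1 iM] _ _] := fracG.
have [||m m0 mC] := @conjg_expg_finite_order G (i D)
    (i @` garside_interval D).
- exact: finite_image.
- move=> _ [a [_ aD] <-]; have [b bD abE] := leL_conj_garside M D a bal aD.
  exists b; first by split=> //; exists b; rewrite mul1g.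
  by rewrite /conjg -iM abE iM mulKg.
exists m => //; apply: commute_group_of_fractions fracG _.
apply: (generates_ind _ _ _ genD) => [|s a sD IHa].
  by rewrite i1; apply: commute1.
by rewrite iM; apply: commuteM => //; apply: mC; exists s.
Qed.

(** * Norm bounds and finiteness of divisors *)

(* [norm_le N a] says that the supremum defining ||a|| is at most N. *)
Definition norm_le {M : monoidType} (N : nat) (a : M) : Prop :=
  forall s, product_of (@atom M) s a -> (size s <= N)%N.

(** A factorisation of [c <> 1] into atoms is nonempty, and appending it lengthens every
    factorisation of [b]. This strict drop drives the descent in the centre. *)
Lemma norm_leMl (M : monoidType) N (b c : M) :
  generates (@atom M) -> norm_le N (b * c) -> c <> 1 ->
  exists2 N', N = N'.+1 & norm_le N' b.
Proof.
move=> gen nbc c1; have [t [tA tE]] := gen c.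
have t0 : (0 < size t)%N.
  by case: t tA tE => // _; rewrite big_nil => /esym.
have len s : product_of (@atom M) s b -> (size s + size t <= N)%N.
  move=> [sA sE]; rewrite -size_cat; apply: nbc; split.
    by move=> x; rewrite mem_cat => /orP[]; [apply: sA|apply: tA].
  by rewrite big_cat /= sE tE.
have [s sb] := gen b; exists N.-1.
  by rewrite prednK // (leq_trans t0) // (leq_trans (leq_addl _ _) (len s sb)).
move=> {sb}s /len; rewrite -(leq_add2r 1) => sN.
case: N {nbc len} sN => [|N] /=; last first.
  rewrite addn1 addn1 ltnS => sN; rewrite -ltnS.
  by apply: leq_trans sN; rewrite -addn1 leq_add2l.
by rewrite addn1 ltnS leqn0 addn_eq0 => /andP[/eqP->].
Qed.

Lemma norm_le_dvd (M : monoidType) N (b c : M) :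
  generates (@atom M) -> norm_le N (b * c) -> norm_le N b.
Proof.
move=> gen nbc; have [c1|c1] := pselect (c = 1).
  by move: nbc; rewrite c1 mulg1.
have [N' -> nb] := norm_leMl _ _ _ _ gen nbc c1.
by move=> s /nb /leqW.
Qed.

Lemma atom_mem_generators (M : monoidType) (S : set M) :
  generates S -> @atom M `<=` S.
Proof.
move=> genS a [a1 airr]; move: a a1 airr.
apply: (generates_ind _ _ _ genS) => // s a sS IHa sa1 irr.
have [s1|a1] := irr s a erefl; last by rewrite a1 mulg1.
by move: sa1 irr; rewrite s1 mul1g; apply: IHa.
Qed.

(** By induction on [N]: splitting off the first atom of a nontrivial element lowers the bound by
    one. *)
Lemma finite_norm_le (M : monoidType) (N : nat) :
  finite_set (@atom M) -> generates (@atom M) ->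
  finite_set [set a : M | norm_le N a].
Proof.
move=> finA gen; elim: N => [|N IHN].
  apply: (sub_finite_set _ (finite_set1 (1 : M))) => a na.
  have [s sa] := gen a; have := na s sa.
  by rewrite leqn0 size_eq0 => /eqP s0; case: sa; rewrite s0 big_nil.
pose B := [set 1 : M] `|`
  [set b * c | b in @atom M & c in [set a | norm_le N a]].
apply: (@sub_finite_set _ _ B); last first.
  by rewrite finite_setU; split; [exact: finite_set1|exact: finite_image2].
move=> a na; have [[|x s] [sA sE]] := gen a; first by left; rewrite -sE big_nil.
right; exists x; first by apply: sA; rewrite mem_head.
exists (\prod_(y <- s) y); last by rewrite -sE big_cons.
move=> t [tA tE]; have := na (x :: t); apply; split.
  move=> y; rewrite inE => /orP[/eqP->|]; last exact: tA.
  by apply: sA; rewrite mem_head.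
by rewrite -sE !big_cons tE.
Qed.

Lemma finite_divisors (M : monoidType) (D a : M) :
  atomic M -> monoid_garside_element D -> finite_set (garside_interval a).
Proof.
move=> [gen nrm] [_ finD genD]; have [N nN] := nrm a.
have finA : finite_set (@atom M).
  exact: sub_finite_set (atom_mem_generators _ _ genD) finD.
apply: sub_finite_set (finite_norm_le _ N finA gen) => b [_ [c bc]].
by apply: (norm_le_dvd _ _ b c gen); rewrite bc.
Qed.

(** For central [a], [b * c = a] gives [b * (c * b) = a * b = b * a], so left and right divisors
    coincide by cancellation. Generation is inherited from the divisors of [D]. *)
Lemma central_garside_element (M : monoidType) (D a : M) :
  atomic M -> monoid_garside_element D -> (forall x, commute a x) ->
  left_cancellative M -> right_cancellative M ->
  leL D a -> monoid_garside_element a.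
Proof.
move=> atM gD aC lc rc [e De]; split; last 1 first.
- move=> b; case: gD => _ _ /(_ b)[s [sD sE]]; exists s; split=> // x /sD.
  move=> [x1 [c xc]]; split=> //; exists (c * e).
  by rewrite mulgA xc.
- move=> b; split=> -[c bc]; exists c.
    by apply: (lc b); rewrite mulgA bc aC.
  by apply: (rc b); rewrite -mulgA bc aC.
- exact: finite_divisors gD.
Qed.

(** * Divisibility and roots of central elements *)

Lemma seq_meet {M : monoidType} (f : nat -> M) (n : nat) :
  is_lattice (@leL M) ->
  exists J, (forall j, (j <= n)%N -> leL J (f j)) /\
    forall w, (forall j, (j <= n)%N -> leL w (f j)) -> leL w J.
Proof.
move=> [[rfl trn _] _ meet]; elim: n => [|n [J [Jf Jm]]].
  by exists (f 0%N); split=> [j|w]; [rewrite leqn0 => /eqP->|apply].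
have [K [KJ Kf Km]] := meet J (f n.+1); exists K; split=> [j|w wf].
  by rewrite leq_eqVlt => /orP[/eqP->//|/Jf]; apply: trn.
by apply: Km; [apply: Jm => j jn; apply: wf; apply: leqW|apply: wf].
Qed.

(** The gcd [K] of the [a * f j] is a multiple [a * u] of their common divisor [a]; cancelling [a],
    [u] divides every [f j], hence [J]. *)
Lemma leL_mul_meet (M : monoidType) (f : nat -> M) (n : nat) (J a w : M) :
  left_cancellative M -> is_lattice (@leL M) ->
  (forall w, (forall j, (j <= n)%N -> leL w (f j)) -> leL w J) ->
  (forall j, (j <= n)%N -> leL w (a * f j)) -> leL w (a * J).
Proof.
move=> lc lat Jm wf; have [K [Kf Km]] := seq_meet (fun j => a * f j) n lat.
have [[_ trn _] _ _] := lat.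
have [u auK] : leL a K by apply: Km => j _; exists (f j).
have uJ : leL u J.
  apply: Jm => j /Kf[v]; rewrite -auK -mulgA => /lc uv.
  by exists v.
apply: trn (Km _ wf) _; case: uJ => v <-; exists v.
by rewrite mulgA auK.
Qed.

(* With J the left gcd of the c^j d^(p-1-j), j < p, left gcds being compatible
   with left multiplication gives dJ <=_L cJ; J can then be cancelled. *)
Lemma central_root_leL (M : monoidType) (c d : M) (p : nat) :
  left_cancellative M -> is_lattice (@leL M) ->
  (forall x, commute c x) -> (forall x, commute d x) ->
  leL (d ^+ p.+1) (c ^+ p.+1) -> leL d c.
Proof.
move=> lc lat cC dC [e dce].
pose f j := c ^+ j * d ^+ (p - j).
have [J [Jf Jm]] := seq_meet f p lat.
have : leL (d * J) (c * J).
  apply: (leL_mul_meet _ f p J c) => // j jp.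
  (* For [j = p], [c * f p = c ^+ p.+1] is a multiple of [d ^+ p.+1 = d * f 0]; for [j < p],
     [c * f j = d * f j.+1]. *)
  move: jp; rewrite leq_eqVlt => /orP[/eqP->|jp].
    have [v Jv] := Jf 0%N isT; exists (v * e).
    rewrite /f subnn expg0 mulg1 -expgS -dce expgS.
    move: Jv; rewrite /f subn0 expg0 mul1g => <-.
    by rewrite !mulgA.
  have [v Jv] := Jf j.+1 jp; exists v.
  rewrite -mulgA Jv /f mulgA dC -mulgA -expgS.
  by rewrite subnSK // mulgA -expgS.
move=> [u]; rewrite cC dC -!mulgA => /lc <-; by exists u.
Qed.

(** Each generator divides [D], hence [d], and central powers of [d] move past the remaining
    factors. This clears denominators in fractions. *)
Lemma divides_central_power (M : monoidType) (D d : M) :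
  monoid_garside_element D -> (forall x, commute d x) -> leL D d ->
  forall b, exists n b', b * b' = d ^+ n.
Proof.
move=> [_ _ genD] dC [e De]; apply: (generates_ind _ _ _ genD) => [|s a].
  by exists 0%N, 1; rewrite mulg1.
move=> [_ [t st]] [n [a' aa']].
exists n.+1, (a' * (t * e)); rewrite mulgA -(mulgA s) aa'.
have -> : s * d ^+ n = d ^+ n * s by apply/commuteX/commute_sym.
by rewrite -mulgA (mulgA s) st De expgSr.
Qed.

(** * A totally ordered centre is cyclic *)

Lemma center_cyclic_of_comparable (M : monoidType) (G : groupType)
    (i : M -> G) :
  atomic M -> monoid_morphism i -> injective i ->
  (forall z, group_center G z -> exists a, z = i a \/ z^-1 = i a) ->
  cyclic_subgroup (group_center G).
Proof.
move=> [gen nrm] [i1 iM] i_inj cmp.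
pose Q N := exists a : M, [/\ norm_le N a, a <> 1 & group_center G (i a)].
have [[N0 QN0]|noQ] := pselect (exists N, Q N); last first.
  have triv a : group_center G (i a) -> a = 1.
    move=> aC; apply: contrapT => a1; have [N nN] := nrm a.
    by apply: noQ; exists N, a.
  exists 1; apply/seteqP; split=> z; last first.
    by move=> [[n|n] _ <-] g; rewrite /= expg1n ?invg1 mulg1 mul1g.
  move=> zC; have [a [za|za]] := cmp z zC; exists (Posz 0) => //=.
    by rewrite za (triv a) ?i1 -?za.
  rewrite -[z]invgK za (triv a) ?i1 ?invg1 -?za //.
  exact: group_centerV.
(* The generator [z0] is a nontrivial central element of the monoid with the least possible norm
   bound. *)
have [|N /asboolP[z0 [z0N z01 z0C]] Nmin] := @ex_minnP (fun N => `[< Q N >]).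
  by exists N0; apply/asboolP.
have minN N' (a : M) : (N' < N)%N -> norm_le N' a -> group_center G (i a) ->
    a = 1.
  move=> N'N nN' aC; apply: contrapT => a1.
  have /Nmin : `[< Q N' >] by apply/asboolP; exists a.
  by rewrite leqNgt N'N.
have pos K a : norm_le K a -> group_center G (i a) ->
    exists n, i a = i z0 ^+ n.
  elim: K a => [|K IHK] a nK aC; have [a1|a1] := pselect (a = 1);
      try by exists 0%N; rewrite a1 i1.
    have [s [sA sE]] := gen a; case: a1.
    have := nK s (conj sA sE); rewrite leqn0 size_eq0 => /eqP s0.
    by rewrite -sE s0 big_nil.
  have zaC : group_center G ((i z0)^-1 * i a).
    exact/group_centerM/aC/group_centerV.
  (* Either [z0] divides [a], and the quotient has smaller norm, or [a] divides [z0], and minimality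
     of [N] leaves only [a = z0]. *)
  have [b [zab|zab]] := cmp _ zaC.
    have ab : a = b * z0.
      by apply: i_inj; rewrite iM -zab zaC mulVKg.
    have [_ [<-] nb] : exists2 K', K.+1 = K'.+1 & norm_le K' b.
      by apply: (norm_leMl _ _ _ z0); rewrite -?ab.
    have [n bn] : exists n, i b = i z0 ^+ n by apply: IHK; rewrite -?zab.
    by exists n.+1; rewrite ab iM bn expgSr.
  have z0b : z0 = a * b.
    by apply: i_inj; rewrite iM -zab invgM invgK mulVKg.
  have [b1|b1] := pselect (b = 1).
    by exists 1%N; rewrite z0b b1 mulg1.
  have [N' NN' nN'] : exists2 N', N = N'.+1 & norm_le N' a.
    by apply: (norm_leMl _ _ _ b); rewrite -?z0b.
  by case: a1; apply: (minN N'); rewrite ?NN'.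
exists (i z0); apply/seteqP; split=> z; last first.
  by move=> [[n|n] _ <-]; [|apply: group_centerV]; apply: group_centerX.
move=> zC; have [a [za|za]] := cmp z zC; have [K nK] := nrm a.
  have [|n an] := pos K a nK; first by rewrite -za.
  by exists (Posz n) => //=; rewrite za.
have [|n an] := pos K a nK.
  by rewrite -za; apply: group_centerV.
case: n an => [|n] an.
  by exists (Posz 0) => //=; rewrite -[z]invgK za an expg0 invg1.
by exists (Negz n) => //=; rewrite -an -za invgK.
Qed.

(** * Cyclic centre implies commensurability *)

Lemma expgzAC (G : groupType) (x : G) (k l : int) :
  expgz (expgz x k) l = expgz (expgz x l) k.
Proof. by case: k l => m [] n /=; rewrite ?expVgn ?invgK expgnAC. Qed.

Lemma expgz_expgn (G : groupType) (x : G) (m : nat) (k : int) :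
  (0 < m)%N -> k <> 0%R ->
  exists2 l : int, l <> 0%R & expgz (x ^+ m) k = expgz x l.
Proof.
case: m => // m _; case: k => [[//|n] _|n _].
  by exists (Posz (m.+1 * n.+1)); rewrite //= expgnA.
by exists (Negz (m.+1 * n.+1).-1); rewrite //= -expgnA mulSn addSn.
Qed.

(** A torsion [D] divides 1, so all its divisors, which generate, equal 1 by antisymmetry. This
    settles the case where a central power of a Garside element is the zeroth power of the
    generator. *)
Lemma garside_torsion_trivial (M : monoidType) (G : groupType) (i : M -> G)
    (D : M) (m : nat) :
  garside_structure i D -> i D ^+ m.+1 = 1 -> forall g : G, g = 1.
Proof.
move=> [[_ _ [[[_ trn anti] _ _] _] _] [[i1 iM] i_inj frac] [_ _ genD]].
rewrite -(morphX _ _ i) // -i1 => /i_inj Dm.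
have D_1 : leL D 1 by exists (D ^+ m); rewrite -expgS.
have M1 (a : M) : a = 1.
  move: a; apply: (generates_ind _ _ _ genD) => // s a [s1 sD] ->.
  by rewrite mulg1; apply: anti => //; apply: trn D_1.
by move=> g; have [a [b ->]] := frac g; rewrite (M1 a) (M1 b) i1 mulgV.
Qed.

Lemma garside_elements_commensurable (G : groupType) (D1 D2 : G) :
  cyclic_subgroup (group_center G) ->
  garside_element D1 -> garside_element D2 -> commensurable D1 D2.
Proof.
move=> [z Zz] [M1 [i1 [E1 [gs1 ->]]]] [M2 [i2 [E2 [gs2 ->]]]].
have [_ frac1 gE1] := gs1; have [_ frac2 gE2] := gs2.
have [[//|m1] _ mC1] := garside_power_central frac1 gE1.
have [[//|m2] _ mC2] := garside_power_central frac2 gE2.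
have trivial_commensurable : (forall g : G, g = 1) ->
    commensurable (i1 E1) (i2 E2).
  move=> G1; exists (Posz 1), (Posz 1); split=> //.
  by exists 1; rewrite (G1 (i1 E1)) (G1 (i2 E2)) /= conj1g.
have [k _ zk] : range (expgz z) (i1 E1 ^+ m1.+1) by rewrite -Zz.
have [l _ zl] : range (expgz z) (i2 E2 ^+ m2.+1) by rewrite -Zz.
have [k0|k0] := pselect (k = 0%R).
  apply/trivial_commensurable/(garside_torsion_trivial _ _ _ _ m1 gs1 _).
  by rewrite -zk k0.
have [l0|l0] := pselect (l = 0%R).
  apply/trivial_commensurable/(garside_torsion_trivial _ _ _ _ m2 gs2 _).
  by rewrite -zl l0.
(* With the two central powers equal to [z] to the [k] and to the [l], raising the first to the [l]
   and the second to the [k] makes them agree. *)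
have [k' k'0 k'E] := expgz_expgn G (i1 E1) m1.+1 l isT l0.
have [l' l'0 l'E] := expgz_expgn G (i2 E2) m2.+1 k isT k0.
exists k', l'; split=> //; exists 1.
by rewrite conjg1 -k'E -l'E -zk -zl expgzAC.
Qed.

(** * Commensurability implies a totally ordered centre *)

Lemma commensurable_central (G : groupType) (g h : G) :
  group_center G h -> commensurable g h ->
  exists k l : int, l <> 0%R /\ expgz g k = expgz h l.
Proof.
move=> hC [k [l [_ l0 [x gh]]]]; exists k, l; split=> //.
have hlC : group_center G (expgz h l).
  by case: l {l0 gh} => n; [|apply: group_centerV]; apply: group_centerX.
by rewrite -[LHS](conjgK x) gh /conjg hlC mulKg.
Qed.

(** The disjunction says that [c ^+ p.+1] is a power of [d] with exponent [q] or [- q], without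
    inverses. Comparing this exponent with [N * p.+1] orders the [p.+1]-st powers, and roots
    preserve the order. *)
Lemma central_pow_comparable (M : monoidType) (c d : M) (N p q : nat) :
  left_cancellative M -> is_lattice (@leL M) ->
  (forall x, commute c x) -> (forall x, commute d x) ->
  c ^+ p.+1 = d ^+ q \/ d ^+ q * c ^+ p.+1 = 1 ->
  leL (d ^+ N) c \/ leL c (d ^+ N).
Proof.
move=> lc lat cC dC.
have dNC x : commute (d ^+ N) x by apply/commute_sym/commuteX/commute_sym.
move=> [cd|cd].
  have [le|/ltnW le] := leqP (N * p.+1) q; [left|right].
    apply: (central_root_leL _ c _ p) => //; exists (d ^+ (q - N * p.+1)).
    by rewrite cd -expgnA -expgnDr subnKC.
  apply: (central_root_leL _ (d ^+ N) _ p) => //.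
  exists (d ^+ (N * p.+1 - q)).
  by rewrite cd -expgnA -expgnDr subnKC.
right; apply: (central_root_leL _ (d ^+ N) _ p) => //.
exists (d ^+ q * (d ^+ N) ^+ p.+1); rewrite mulgA.
have -> : c ^+ p.+1 * d ^+ q = d ^+ q * c ^+ p.+1.
  by apply/commuteX/commute_sym/commuteX/commute_sym.
by rewrite cd mul1g.
Qed.

(* If d is a central power of D and z is central, then z d^N is, for N large,
   a central element of the monoid divisible by D, hence a Garside element. *)
Lemma center_comparable (M : monoidType) (G : groupType) (i : M -> G) (z : G) :
  garside_monoid M -> group_of_fractions i ->
  (forall D1 D2 : G, garside_element D1 -> garside_element D2 ->
     commensurable D1 D2) ->
  group_center G z -> exists a, z = i a \/ z^-1 = i a.
Proof.
move=> gM fracG com zC; have [atM [lc rc] [lat _] [D gD]] := gM.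
have [[i1 iM] i_inj frac] := fracG; have iX := morphX _ _ i (conj i1 iM).
have [[//|m] _ mC] := garside_power_central fracG gD.
have liftC c : group_center G (i c) -> forall x, commute c x.
  by move=> cC x; apply: i_inj; rewrite !iM.
pose d := D ^+ m.+1.
have dG : group_center G (i d) by rewrite /d iX; exact: mC.
have dC := liftC d dG.
have [a [b zab]] := frac z.
have Dd : leL D d by exists (D ^+ m); rewrite -expgS.
have [n [b' bb']] := divides_central_power M D d gD dC Dd b.
(* Since [b * b' = d ^+ n], [a * b'] is [z] times [d ^+ n]; the extra factor [d] ensures that [D]
   divides [c]. *)
pose c := d * (a * b').
have cE : i c = z * i (d ^+ n.+1).
  have ab : i a = z * i b by rewrite zab mulgVK.
  by rewrite expgS -bb' !iM ab !mulgA (zC (i d)).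
have cG : group_center G (i c) by rewrite cE iX; apply/group_centerM/group_centerX.
have cC := liftC c cG.
have gc : monoid_garside_element c.
  apply: (central_garside_element _ D) => //.
  by case: Dd => e De; exists (e * (a * b')); rewrite mulgA De.
have [|k [l [l0 kl]]] := commensurable_central G (i D) (i c) cG.
  by apply: com; [exists M, i, D|exists M, i, c].
(* The two cases are equal and opposite signs of [k] and [l]; [l <> 0] makes the exponent of [c] a
   successor. *)
have [p [q cd]] : exists p q,
    c ^+ p.+1 = D ^+ q \/ D ^+ q * c ^+ p.+1 = 1.
  case: k l l0 kl => q [[//|p]|p] _ /= kl.
  - by exists p, q; left; apply: i_inj; rewrite !iX kl.
  - by exists p, q; right; apply: i_inj; rewrite iM !iX kl i1 mulVg.
  - by exists p, q.+1; right; apply: i_inj; rewrite iM !iX -kl i1 mulgV.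
  - by exists p, q.+1; left; apply: i_inj; rewrite !iX; apply: invg_inj.
(* Raising the relation to the power [m.+1] replaces [D] by [d]; as [c] is [z] times [d ^+ n.+1],
   comparing [c] with [d ^+ n.+1] decides whether [z] or its inverse lies in the monoid. *)
have [|[u cu]|[u cu]] := central_pow_comparable M c d n.+1 (p.+1 * m.+1).-1 q
  lc lat cC dC.
- rewrite prednK ?muln_gt0 // /d.
  rewrite expgnA [(D ^+ _) ^+ _]expgnAC.
  case: cd => cd; [left|right]; first by rewrite cd.
  rewrite -expgMn ?cd ?expg1n //.
  by apply/commute_sym/commuteX2/commute_sym/commute_sym.
- exists u; left; apply: (mulIg (i (d ^+ n.+1))); rewrite -cE -cu iM.
  by rewrite iX; apply: group_centerX.
- exists u; right; apply: (mulgI (i c)); rewrite -iM cu cE zC -mulgA.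
  by rewrite mulgV mulg1.
Qed.

Theorem theorem3p1 (G : groupType) (hG : garside_group G) :
  cyclic_subgroup (group_center G) <->
  (forall D1 D2 : G, garside_element D1 -> garside_element D2 ->
     commensurable D1 D2).
Proof.
split=> [Zcyc D1 D2|com]; first exact: garside_elements_commensurable.
have [M [i [gM fracG]]] := hG; have [[i_morph i_inj _] [atM _ _ _]] := (fracG, gM).
apply: (center_cyclic_of_comparable M G i) => // z.
exact: center_comparable.
Qed.
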